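(* For all integers $n\ge 0$ and $k\ge 0$, the map $E_\infty$ is a bijection from the set of odd-special Dyck paths of length $n$ with exactly $k$ special steps to the set of big Schröder paths of length $n$ with exactly $k$ horizontal steps.
   Context: **Paths.** All lattice paths of length $n$ start at $(0,0)$, end at $(n,0)$, never go below the $x$-axis, and consist of upsteps U $=(1,1)$, downsteps $(1,-1)$, and double horizontal steps HH $=(2,0)$. A double horizontal step is treated as one indivisible ''horizontal step'' and contributes $2$ to the length. Each downstep is either ordinary (written D) or carries the label ''special'' (written d); paths with different labels are different. A Dyck path has no horizontal steps. A big Schröder path is a path of upsteps, ordinary downsteps and horizontal steps (no special steps). An odd-special Dyck path is a Dyck path in which an arbitrary subset of the downsteps that leave from odd height (i.e. whose starting height is odd) are labeled special. **Matching upstep.** The upstep matching a downstep $d$ is the rightmost upstep to the left of $d$ that ends at the height from which $d$ leaves. **The map $E$.** If a path has no special steps, $E$ leaves it unchanged. Otherwise take the leftmost special step $s$. (Flatten) If $s$ is immediately preceded by an upstep, replace that upstep and $s$ by one horizontal step HH. (Slide) If $s$ is immediately preceded by a downstep $d$ (necessarily ordinary), let $u$ be the upstep matching $d$ and let $P$ be the (possibly empty) subpath strictly between $u$ and $d$; replace the portion $u\,P\,d\,s$ of the path by HH $P$ D, i.e. replace $u$ with a horizontal step, delete $d$, let $P$ follow the horizontal step, and make $s$ an ordinary downstep. For paths obtained from odd-special Dyck paths by repeatedly applying $E$ these are the only cases that occur. **The map $E_\infty$.** For an odd-special Dyck path, $E_\infty$ is the result of applying $E$ repeatedly until no special step remains.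 *)

(* Defs.v *)
From HB Require Import structures.
From mathcomp Require Import all_boot all_order all_algebra zify.
From mathcomp Require Import boolp classical_sets functions.

Set Implicit Arguments.
Unset Strict Implicit.
Unset Printing Implicit Defensive.

Import Order.TTheory GRing.Theory Num.Theory.

Local Open Scope ring_scope.

(* The letters U, D, d and HH; HH is a single letter. *)
Inductive step := Up | Down | Special | Horiz.

Definition step_eq (s t : step) : bool :=
  match s, t with
  | Up, Up | Down, Down | Special, Special | Horiz, Horiz => true
  | _, _ => false
  end.

Lemma step_eqP : Equality.axiom step_eq.
Proof. by case; case; constructor. Qed.

HB.instance Definition _ := hasDecEq.Build step step_eqP.

Definition rise (s : step) : int :=
  match s with Up => 1 | Down | Special => -1 | Horiz => 0 end.

Definition step_length (s : step) : nat := if s is Horiz then 2%N else 1%N.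

Definition path_length (p : seq step) : nat := (\sum_(s <- p) step_length s)%N.

(* Height after the first i steps, i.e. the height from which step i
   (counting from 0) leaves. *)
Definition height (p : seq step) (i : nat) : int := \sum_(s <- take i p) rise s.

Definition lattice_path (n : nat) (p : seq step) : Prop :=
  [/\ path_length p = n,
      forall i : nat, 0 <= height p i
    & height p (size p) = 0].

Definition dyck_path (n : nat) (p : seq step) : Prop :=
  lattice_path n p /\ Horiz \notin p /\ Special \notin p.

Definition big_schroeder_path (n : nat) (p : seq step) : Prop :=
  lattice_path n p /\ Special \notin p.

Definition unlabel (s : step) : step := if s is Special then Down else s.

(* Heights are nonnegative along a path, so the absolute value only converts
   to nat. *)
Definition odd_special_dyck_path (n : nat) (p : seq step) : Prop :=
  dyck_path n (map unlabel p) /\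
  (forall i : nat, nth Horiz p i = Special -> odd `|height p i|%N).

(* Position of the upstep matching the downstep at position j: the rightmost
   upstep before j ending at the height from which step j leaves. In a path
   that starts at height 0 and leaves from positive height at j there always
   is one; otherwise the value is a meaningless 0. *)
Definition matching_up (p : seq step) (j : nat) : nat :=
  (\max_(m < j | (nth Horiz p m == Up) && (height p m.+1 == height p j)) m)%N.

(* Here i.+1 is the position of the leftmost special step s, so that step i
   immediately precedes s and drop i.+2 p is what follows s. *)
Definition E (p : seq step) : seq step :=
  if Special \notin p then p else
  match index Special p with
  | 0%N => p
  | i.+1 =>
    match nth Horiz p i with
    | Up => take i p ++ Horiz :: drop i.+2 p
    | Down =>
      let m := matching_up p i in
      take m p ++ Horiz :: drop m.+1 (take i p) ++ Down :: drop i.+2 p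
    | _ => p
    end
  end.

(* Every effective application of E removes exactly one special step, so this
   many applications suffice; see E_inftyE. *)
Definition E_infty (p : seq step) : seq step := iter (count_mem Special p) E p.

Lemma matching_up_le p j : (matching_up p j <= j)%N.
Proof. by apply/bigmax_leqP => m _; apply: ltnW. Qed.

Lemma count_Special_E p :
  E p = p \/ count_mem Special p = (count_mem Special (E p)).+1.
Proof.
rewrite /E; case: ifPn => [_|]; first by left.
rewrite negbK => sp; case ei: (index Special p) => [|i]; first by left.
have lt_i : (i.+1 < size p)%N by rewrite -ei index_mem.
have pre k : (k <= i.+1)%N -> count_mem Special (take k p) = 0%N.
  move=> le_k; apply/count_memPn/negP => s_k.
  have := index_cat Special (take k p) (drop k p).
  rewrite cat_take_drop s_k ei => e.
  have := s_k; rewrite -index_mem -e size_take_min; lia.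
have cp : count_mem Special p = (count_mem Special (drop i.+2 p)).+1.
  rewrite -{1}(cat_take_drop i.+1 p) count_cat pre // add0n.
  by rewrite (drop_nth Horiz) //= -ei nth_index //=.
case: (nth Horiz p i); try by left.
  by right; rewrite count_cat /= pre // cp.
right; set m := matching_up p i.
have le_m : (m <= i)%N by apply: matching_up_le.
rewrite count_cat /= count_cat /= pre; last by lia.
have -> : count_mem Special (drop m.+1 (take i p)) = 0%N.
  apply/count_memPn/negP => /mem_drop; apply/negP/count_memPn.
  by rewrite pre.
by rewrite cp.
Qed.

Lemma E_fix p : Special \notin p -> E p = p.
Proof. by rewrite /E => ->. Qed.

Lemma E_inftyE p m : Special \notin iter m E p -> E_infty p = iter m E p.
Proof.
rewrite /E_infty; elim: m p => [|m IHm] p.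
  by rewrite /= => /count_memPn ->.
have [ep|cp] := count_Special_E p.
  have fixE k : iter k E p = p by elim: k => //= k ->.
  by rewrite !fixE.
by rewrite iterSr => /IHm <-; rewrite cp iterSr.
Qed.

(* Main.v *)
(* Read a labelled Dyck path from left to right, and treat each special step as
   soon as it is read; E_infty is this letter-by-letter process.  The words
   obtained from prefixes of odd-special Dyck paths are exactly the nonnegative
   words without special steps in which every horizontal step at odd height is
   later followed by a visit to a lower height: a slide puts its horizontal step
   at odd height and ends with a downstep below it, whereas a flattening puts
   it at even height.  Among such words the last letter read can be recovered.
   A final Horiz comes from a flattening.  A final Down comes from a slide iff
   deleting it leaves some horizontal step at odd height without a later lower
   point, and the slide is then undone at the leftmost such horizontal step. *)
Require Import Defs.
From mathcomp Require Import all_boot all_order all_algebra zify.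
From mathcomp Require Import boolp classical_sets functions.

Set Implicit Arguments.
Unset Strict Implicit.
Unset Printing Implicit Defensive.

Import Order.TTheory GRing.Theory Num.Theory.

Local Open Scope ring_scope.

(** * Heights and nonnegative words *)

Definition ht (p : seq step) : int := \sum_(s <- p) rise s.

Lemma ht_nil : ht [::] = 0.
Proof. exact: big_nil. Qed.

Lemma ht_cons s p : ht (s :: p) = rise s + ht p.
Proof. exact: big_cons. Qed.

Lemma ht_cat p q : ht (p ++ q) = ht p + ht q.
Proof. exact: big_cat. Qed.

Lemma ht_rcons p s : ht (rcons p s) = ht p + rise s.
Proof. by rewrite -cats1 ht_cat ht_cons ht_nil addr0. Qed.

Definition htE := (ht_nil, ht_cons, ht_cat, ht_rcons).

Lemma height0 p : height p 0 = 0.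
Proof. by rewrite /height take0 big_nil. Qed.

Lemma height_oversize p i : (size p <= i)%N -> height p i = ht p.
Proof. by move=> le_pi; rewrite /height take_oversize. Qed.

Lemma height_size p : height p (size p) = ht p.
Proof. exact: height_oversize. Qed.

Lemma height_cat p q i :
  height (p ++ q) i =
  if (i <= size p)%N then height p i else ht p + height q (i - size p).
Proof.
rewrite /height take_cat; case: ltngtP => [//|lt_pi|->].
  by rewrite big_cat.
by rewrite subnn take0 cats0 take_size.
Qed.

Lemma height_catr p q i : height (p ++ q) (size p + i) = ht p + height q i.
Proof.
rewrite height_cat; case: ifP => [le_pi|_]; last by rewrite addKn.
have -> : i = 0%N by lia.
by rewrite addn0 height_size height0 addr0.
Qed.

Lemma height_cons s p i : height (s :: p) i.+1 = rise s + height p i.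
Proof. by rewrite /height /= big_cons. Qed.

Lemma heightS p i :
  (i < size p)%N -> height p i.+1 = height p i + rise (nth Horiz p i).
Proof.
move=> lt_ip; rewrite /height (take_nth Horiz lt_ip) -cats1 big_cat /=.
by rewrite big_seq1.
Qed.

(** The starting height is a parameter so that the condition splits at any point of a word. *)
Definition nonneg_from (h : int) (p : seq step) : Prop :=
  forall i : nat, 0 <= h + height p i.

Lemma nonneg_from_cat h p q :
  nonneg_from h (p ++ q) <-> nonneg_from h p /\ nonneg_from (h + ht p) q.
Proof.
split=> [nn|[nnp nnq] i].
  split=> i; last by rewrite -addrA -height_catr.
  have := nn (minn i (size p)); rewrite height_cat geq_minr.
  by case: leqP => // le_pi; rewrite height_size (height_oversize (ltnW le_pi)).
by rewrite height_cat; case: ifP => _ //; rewrite addrA.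
Qed.

Lemma nonneg_from_nil h : nonneg_from h [::] <-> 0 <= h.
Proof.
split=> [/(_ 0%N)|h0 i]; first by rewrite height0 addr0.
by rewrite height_oversize // ht_nil addr0.
Qed.

Lemma nonneg_from_cons h s p :
  nonneg_from h (s :: p) <-> 0 <= h /\ nonneg_from (h + rise s) p.
Proof.
split=> [nn|[h0 nn] [|i]].
- split=> [|i]; first by have := nn 0%N; rewrite height0 addr0.
  by rewrite -addrA -height_cons.
- by rewrite height0 addr0.
by rewrite height_cons addrA.
Qed.

Lemma nonneg_from_rcons h p s :
  nonneg_from h (rcons p s) <-> nonneg_from h p /\ 0 <= h + ht p + rise s.
Proof.
rewrite -cats1 nonneg_from_cat nonneg_from_cons nonneg_from_nil.
split=> [[? [_ ?]]|[nn ?]]; first by [].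
by split=> //; split=> //; rewrite -height_size.
Qed.

Lemma nonneg_from_ht h p : nonneg_from h p -> 0 <= h + ht p.
Proof. by move=> nn; rewrite -height_size. Qed.

Lemma nonneg_from_le h h' p :
  h <= h' -> nonneg_from h p -> nonneg_from h' p.
Proof. by move=> le_h nn i; have := nn i; lia. Qed.

(** * Excursions and settled horizontal steps *)

Definition excursion (p : seq step) : Prop := nonneg_from 0 p /\ ht p = 0.

Lemma excursion_nil : excursion [::].
Proof. by split; [apply/nonneg_from_nil | rewrite ht_nil]. Qed.

Lemma excursion_cat p q : excursion p -> excursion q -> excursion (p ++ q).
Proof.
move=> [nnp hp] [nnq hq]; split; last by rewrite ht_cat hp hq.
by apply/nonneg_from_cat; rewrite hp addr0.
Qed.

Lemma excursion_horiz p : excursion p -> excursion (Horiz :: p).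
Proof. by case=> nn hp; split; [apply/nonneg_from_cons | rewrite !htE hp]. Qed.

Lemma excursion_arch p : excursion p -> excursion (Up :: rcons p Down).
Proof.
move=> [nn hp]; split; last by rewrite !htE hp.
apply/nonneg_from_cons; split=> //; apply/nonneg_from_rcons.
by rewrite hp; split=> //; apply: nonneg_from_le nn.
Qed.

(** Last-passage decomposition, by induction on the length. Before a final [Down] the height is at
    least 2: the upstep matching it is found first, and the induction applies again to what precedes
    that arch. *)
Lemma last_upstep p :
  Special \notin p -> 0 < ht p ->
  exists a q, p = a ++ Up :: q /\ excursion q.
Proof.
have [m] := ubnP (size p); elim: m p => // m IHm p.
case: (lastP p) => [|{}p s]; first by rewrite ht_nil.
rewrite size_rcons ltnS mem_rcons in_cons ht_rcons => lt_pm.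
case/norP => sNs sp hp.
case: s sNs hp => //= _ hp.
- by exists p, [::]; rewrite cats1; split=> //; apply: excursion_nil.
- have [|a [q [def_p eq]]] := IHm p lt_pm sp; first by lia.
  have [ha sa] : 0 < ht a /\ Special \notin a.
    move: hp sp eq.2; rewrite def_p !htE mem_cat /= => hp /norP [sa _] hq.
    by split=> //; lia.
  have [|b [r [def_a er]]] := IHm a _ sa ha.
    by move: lt_pm; rewrite def_p size_cat /=; lia.
  exists b, (r ++ Up :: rcons q Down); split.
    by rewrite def_p def_a rcons_cat /= -catA.
  by apply: excursion_cat => //; apply: excursion_arch.
have [|a [q [-> eq]]] := IHm p lt_pm sp; first by lia.
exists a, (rcons q Horiz); rewrite rcons_cat; split=> //.
rewrite -cats1; apply: excursion_cat => //.
exact/excursion_horiz/excursion_nil.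
Qed.

(* height is constant beyond the end of a word, so j may safely exceed size p. *)
Definition settled_from (h : int) (p : seq step) : Prop :=
  forall i : nat, nth Down p i = Horiz -> odd `|(h + height p i)%R|%N ->
  exists2 j : nat, (i < j)%N & height p j < height p i.

Lemma nth_Horiz_size p i : nth Down p i = Horiz -> (i < size p)%N.
Proof. by case: ltnP => // le_pi; rewrite nth_default. Qed.

Lemma settled_from_cat h p q :
  settled_from h p -> settled_from (h + ht p) q -> settled_from h (p ++ q).
Proof.
move=> sp sq i; rewrite nth_cat; case: ltnP => [lt_ip|le_pi] pi.
  rewrite height_cat (ltnW lt_ip) => oi.
  have [j lt_ij lt_h] := sp i pi oi.
  (* A witness past the end of [p] is cut back to [size p], where [p] has the same height and [q]
     has not begun. *)
  exists (minn j (size p)); first by lia.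
  rewrite height_cat geq_minr; case: leqP => // le_pj.
  by rewrite height_size -(height_oversize (ltnW le_pj)).
rewrite -(subnKC le_pi) height_catr addrA => oi.
have [j lt_ij lt_h] := sq _ pi oi.
by exists (size p + j)%N; [lia | rewrite height_catr ltrD2l].
Qed.

(** If the later lower point lies in [q], the end of [p] is at most as high, since [q] never goes
    below its start. *)
Lemma settled_from_prefix h p q :
  settled_from h (p ++ q) -> nonneg_from 0 q -> settled_from h p.
Proof.
move=> spq nnq i pi oi; have lt_ip := nth_Horiz_size pi.
have := spq i; rewrite nth_cat lt_ip height_cat (ltnW lt_ip).
case=> // j lt_ij; rewrite height_cat; case: leqP => le_jp lt_h.
  by exists j.
by exists (size p) => //; rewrite height_size; have := nnq (j - size p)%N; lia.
Qed.

Lemma settled_from_nil h : settled_from h [::].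
Proof. by case. Qed.

Lemma settled_from_cons h s p :
  (s = Horiz -> ~~ odd `|h|%N) -> settled_from (h + rise s) p ->
  settled_from h (s :: p).
Proof.
move=> hs sp; rewrite -cat1s; apply: settled_from_cat; last first.
  by rewrite ht_cons ht_nil addr0.
case=> [/= /hs|[]//]; rewrite height0 addr0 => /negP; contradiction.
Qed.

Lemma settled_from_rcons h p s :
  (s = Horiz -> ~~ odd `|(h + ht p)%R|%N) -> settled_from h p ->
  settled_from h (rcons p s).
Proof.
move=> hs sp; rewrite -cats1; apply: settled_from_cat => //.
by apply: settled_from_cons => //; apply: settled_from_nil.
Qed.

(** Over an even base, odd height means strictly above the base, to which the excursion returns at
    its end. *)
Lemma settled_from_excursion h p :
  ~~ odd `|h|%N -> excursion p -> settled_from h p.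
Proof.
move=> eh [nn hp] i pi oi; have lt_ip := nth_Horiz_size pi.
by exists (size p) => //; rewrite height_size hp; have := nn i; lia.
Qed.

(** The closing [Down] ends below every point of the excursion, whatever the parities. *)
Lemma settled_from_descent h p : excursion p -> settled_from h (rcons p Down).
Proof.
move=> [nn hp] i pi _; have := nth_Horiz_size pi; rewrite size_rcons => lt_ip.
exists (size (rcons p Down)); first by rewrite size_rcons.
rewrite height_size ht_rcons hp -cats1 height_cat -ltnS lt_ip /=.
by have := nn i; lia.
Qed.

Lemma open_not_settled a p :
  odd `|ht a|%N -> nonneg_from 0 p -> ~ settled_from 0 (a ++ Horiz :: p).
Proof.
move=> oa nn /(_ (size a)); rewrite nth_cat ltnn subnn /= add0r.
rewrite height_cat leqnn height_size => -[//|//|j lt_aj].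
rewrite height_cat leqNgt lt_aj /=; case: (j - size a)%N => [|i].
  by rewrite height0; lia.
by rewrite height_cons /=; have := nn i; lia.
Qed.

(** This finds the place where a slide is to be undone. Any unsettled step will do unless the part
    before it is unsettled too; then the induction applies to that shorter part. *)
Lemma not_settled_leftmost p :
  ~ settled_from 0 p ->
  exists a q, [/\ p = a ++ Horiz :: q, odd `|ht a|%N, nonneg_from 0 q
                & settled_from 0 a].
Proof.
have [m] := ubnP (size p); elim: m p => // m IHm p lt_pm nsp.
have [i [pi oi nj]] : exists i, [/\ nth Down p i = Horiz,
    odd `|height p i|%N & forall j, (i < j)%N -> height p i <= height p j].
  move: nsp => /existsNP [i /not_implyP [pi /not_implyP [oi nj]]].
  exists i; rewrite add0r in oi; split=> // j lt_ij.
  by rewrite leNgt; apply/negP => lt_h; apply: nj; exists j.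
have lt_ip := nth_Horiz_size pi.
have def_p : p = take i p ++ Horiz :: drop i.+1 p.
  by rewrite -pi -drop_nth // cat_take_drop.
have hi : ht (take i p) = height p i by [].
have nn : nonneg_from 0 (drop i.+1 p).
  move=> j; have : height p (i + j.+1) = height p i + height (drop i.+1 p) j.
    rewrite {1}def_p -{3}(size_takel (ltnW lt_ip)) height_catr hi.
    by rewrite height_cons add0r.
  by have := nj (i + j.+1)%N; lia.
have [sa|nsa] := pselect (settled_from 0 (take i p)).
  by exists (take i p), (drop i.+1 p).
have [|a [q [def_a oa nnq sa]]] := IHm _ _ nsa; first by rewrite size_takel; lia.
exists a, (q ++ Horiz :: drop i.+1 p); split=> //.
  by rewrite {1}def_p def_a -catA.
apply/nonneg_from_cat; split=> //; have := nonneg_from_ht nnq => hq.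
apply/nonneg_from_cons; split=> //; apply: nonneg_from_le nn.
by rewrite addr0.
Qed.

(** * Reading one special step *)

Definition good (w : seq step) : Prop :=
  [/\ nonneg_from 0 w, settled_from 0 w & Special \notin w].

Definition act (w : seq step) (s : step) : seq step :=
  if s == Special then E (rcons w s) else rcons w s.

(** The two cases of [E] on a word followed by a special step. The factorisation displays the
    matching upstep, so [matching_up] need not be computed again. *)
Variant slide : seq step -> seq step -> Prop :=
| SlideFlat a : slide (rcons a Up) (rcons a Horiz)
| SlideArch a p of excursion p :
    slide (a ++ Up :: rcons p Down) (a ++ Horiz :: rcons p Down).

(** An upstep inside [p] ending at the height where [p] ends would start one unit below the start of
    [p], which an excursion forbids. *)
Lemma matching_up_arch a p r :
  excursion p ->
  matching_up (a ++ Up :: p ++ Down :: r) (size a + (size p).+1) = size a.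
Proof.
move=> [nn hp]; rewrite /matching_up.
set w := a ++ _; have hj : height w (size a + (size p).+1) = ht a + 1.
  rewrite height_catr height_cons -[size p]addn0 height_catr hp height0.
  by rewrite !addr0.
have h1 : height w (size a).+1 = ht a + 1.
  by rewrite -addn1 height_catr height_cons height0 addr0.
apply/eqP; rewrite eqn_leq; apply/andP; split; last first.
  have lt_a : (size a < size a + (size p).+1)%N by lia.
  apply: (bigop.bigmax_sup (Ordinal lt_a)) => //=.
  by rewrite h1 hj eqxx nth_cat ltnn subnn.
apply/bigop.bigmax_leqP => -[m /= lt_m] /andP [/eqP wm /eqP hm].
rewrite leqNgt; apply/negP => lt_am.
have [i def_m] : exists i, m = (size a + i.+1)%N.
  by exists (m - size a).-1; lia.
have lt_ip : (i < size p)%N by lia.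
move: wm hm; rewrite hj def_m -addnS height_catr height_cons nth_cat.
rewrite ltnNge leq_addr addKn /= nth_cat lt_ip => pi.
rewrite height_cat lt_ip heightS // pi /=.
by have := nn i; lia.
Qed.

(** The rest [r] is arbitrary, so [E] can act while later letters, special ones included, are still
    unread. *)
Lemma E_slide w w' r :
  slide w w' -> Special \notin w -> E (rcons w Special ++ r) = w' ++ r.
Proof.
rewrite cat_rcons => sl sw; rewrite /E mem_cat mem_head orbT /=.
rewrite index_cat (negPf sw) /= addn0.
case: sl sw => [a|a p ep] _.
  rewrite size_rcons nth_cat size_rcons leqnn nth_rcons ltnn eqxx.
  rewrite !cat_rcons take_size_cat //; congr (_ ++ _ :: _).
  by rewrite -addn2 addnC -drop_drop drop_size_cat //= drop0.
rewrite size_cat /= size_rcons addnS -!catA /= cat_rcons.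
(* Position of the [Down] just before the special step. *)
set i := (size a + (size p).+1)%N.
rewrite nth_cat ltnNge leq_addr /= addKn /= nth_cat ltnn subnn /=.
rewrite matching_up_arch // take_size_cat //; congr (_ ++ _ :: _).
rewrite take_cat ltnNge leq_addr addKn /= take_size_cat // drop_cat.
rewrite ltnNge leqnSn /= subSnn /= drop0 cat_rcons; congr (_ ++ _ :: _).
rewrite drop_cat ltnNge (_ : _ <= _)%N /=; last by rewrite /i; lia.
rewrite (_ : (i.+2 - size a)%N = (size p).+3) /=; last by rewrite /i; lia.
by rewrite -addn2 addnC -drop_drop drop_size_cat //= drop0.
Qed.

Lemma E_rcons_slide w w' :
  slide w w' -> Special \notin w -> E (rcons w Special) = w'.
Proof. by move=> sl sw; have := E_slide [::] sl sw; rewrite !cats0. Qed.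

Lemma act_slide w w' :
  slide w w' -> Special \notin w -> act w Special = w'.
Proof. exact: E_rcons_slide. Qed.

Lemma slide_exists w : good w -> odd `|ht w|%N -> exists w', slide w w'.
Proof.
case: (lastP w) => [|{}w s]; first by rewrite ht_nil.
rewrite /good mem_rcons in_cons ht_rcons.
case=> /nonneg_from_rcons [nn]; rewrite add0r => h1 st /norP [sNs sw] ow.
case: s h1 st sNs ow => //= h1 st _ ow.
- by exists (rcons w Horiz); constructor.
- have [|a [p [-> ep]]] := last_upstep sw; first by lia.
  by exists (a ++ Horiz :: rcons p Down); rewrite rcons_cat; constructor.
(* A final [Horiz] at odd height has no later lower point, so a settled word excludes it. *)
rewrite addr0 in ow.
case: (@open_not_settled w [::]) => //; first exact/nonneg_from_nil.
by rewrite cats1.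
Qed.

(** In the flat case oddness puts the new horizontal step at even height. In the arch case it makes
    [ht a] positive, so the closing [Down] stays nonnegative, and that [Down] settles the new
    horizontal step and all of [p]. *)
Lemma slide_good w w' :
  slide w w' -> good w -> odd `|ht w|%N -> good w'.
Proof.
case=> [a|a p ep] [nn st sw] ow; split.
- move: nn => /nonneg_from_rcons [nn _]; apply/nonneg_from_rcons; split=> //.
  by rewrite addr0; apply: nonneg_from_ht.
- apply: settled_from_rcons; first by move: ow; rewrite ht_rcons /=; lia.
  apply: (@settled_from_prefix _ _ [:: Up]); first by rewrite cats1.
  by apply/nonneg_from_cons; split=> //; apply/nonneg_from_nil.
- by move: sw; rewrite !mem_rcons !in_cons.
- move: nn => /nonneg_from_cat [nna]; have [nnp hp] := ep; move: ow.
  have := nonneg_from_ht nna; rewrite !htE hp /= => ha ow _.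
  apply/nonneg_from_cat; split=> //.
  apply/nonneg_from_cons; split=> //; apply/nonneg_from_rcons; split.
    by apply: nonneg_from_le nnp; rewrite addr0.
  by rewrite hp /=; lia.
- apply: settled_from_cat.
    by apply: settled_from_prefix st _; case: (excursion_arch ep).
  by rewrite -rcons_cons; apply/settled_from_descent/excursion_horiz.
by move: sw; rewrite !mem_cat !in_cons.
Qed.

Lemma path_length_cat p q :
  path_length (p ++ q) = (path_length p + path_length q)%N.
Proof. exact: big_cat. Qed.

Lemma path_length_cons s p :
  path_length (s :: p) = (step_length s + path_length p)%N.
Proof. exact: big_cons. Qed.

Lemma path_length_rcons p s :
  path_length (rcons p s) = (path_length p + step_length s)%N.
Proof. by rewrite -cats1 path_length_cat /path_length big_seq1. Qed.

Definition path_lengthE :=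
  (path_length_cat, path_length_cons, path_length_rcons).

Lemma slide_stats w w' : slide w w' ->
  [/\ ht w' = ht w - 1, path_length w' = (path_length w).+1
    & count_mem Horiz w' = (count_mem Horiz w).+1].
Proof.
case=> [a|a p _]; rewrite !htE !path_lengthE -?cats1 !count_cat /= ?count_cat /=;
  by split; lia.
Qed.

(** The last letter tells the two kinds of slide apart. For arches, the position of the new
    horizontal step is determined by comparing the two prefixes. *)
Lemma slide_inj w1 w2 w : slide w1 w -> slide w2 w ->
  good w1 -> good w2 -> odd `|ht w1|%N -> odd `|ht w2|%N -> w1 = w2.
Proof.
(* Were [a1] shorter, [a2] would extend [rcons a1 Horiz] by a prefix of the excursion [p1], leaving
   that odd-height step unsettled in [a2]. *)
have le_size a1 a2 p1 p2 : a1 ++ Horiz :: p1 = a2 ++ Horiz :: p2 ->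
    excursion p1 -> settled_from 0 a2 -> odd `|ht a1|%N -> (size a2 <= size a1)%N.
  move=> eqa [nn _] st o1; rewrite leqNgt; apply/negP => lt_a.
  have /eqP := congr1 (take (size a1)) eqa.
  rewrite take_size_cat // takel_cat 1?ltnW // => /eqP def_a1.
  have /eqP := congr1 (drop (size a1)) eqa.
  rewrite drop_size_cat // drop_cat lt_a => /eqP eqp.
  have := cat_take_drop (size a1) a2; rewrite -def_a1.
  case: (drop _ a2) eqp => [_ def_a|_ c [<- def_p] def_a].
    by move: lt_a; rewrite -def_a cats0 ltnn.
  move: nn; rewrite def_p => /nonneg_from_cat [nn _].
  by apply: (open_not_settled o1 nn); rewrite def_a.
have arch a p : excursion p -> good (rcons (a ++ Up :: p) Down) ->
    odd `|ht (rcons (a ++ Up :: p) Down)|%N ->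
    settled_from 0 a /\ odd `|ht a|%N.
  rewrite rcons_cat rcons_cons => ep [_ st _]; rewrite ht_cat (excursion_arch ep).2 addr0; split=> //.
  by apply: settled_from_prefix st _; case: (excursion_arch ep).
case=> [a1|a1 p1 e1] sl2; inversion sl2 as [a2 def_w1 eqw|a2 p2 e2 def_w1 eqw].
- by move: eqw => /rcons_inj [->].
- by move: eqw; rewrite -rcons_cons -rcons_cat => /rcons_inj [].
- by move: eqw; rewrite -rcons_cons -rcons_cat => /rcons_inj [].
move: eqw; rewrite -!rcons_cons -!rcons_cat => /rcons_inj [eqw].
move=> g1 g2 o1 o2.
have [st1 oa1] := arch _ _ e1 g1 o1; have [st2 oa2] := arch _ _ e2 g2 o2.
have le12 := le_size _ _ _ _ eqw e2 st1 oa2.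
have le21 := le_size _ _ _ _ (esym eqw) e1 st2 oa1.
have := eqw => /eqP; rewrite eqseq_cat; last by apply/eqP; rewrite eqn_leq le21.
by case/andP => /eqP -> /eqP [->].
Qed.

(** * Reading one letter is a bijection *)

Definition admissible (w : seq step) (s : step) : Prop :=
  [/\ s != Horiz, 0 <= ht w + rise s & s = Special -> odd `|ht w|%N].

Lemma act_good w s : good w -> admissible w s -> good (act w s).
Proof.
move=> gw [sH hs so]; rewrite /act; case: eqVneq => [def_s|sS].
  have ow := so def_s; have [w' sl] := slide_exists gw ow.
  have [_ _ sw] := gw; rewrite def_s (E_rcons_slide sl sw).
  exact: slide_good sl gw ow.
case: gw => nn st sw; split.
- by apply/nonneg_from_rcons; rewrite add0r.
- by apply: settled_from_rcons => // /eqP; rewrite (negPf sH).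
by rewrite mem_rcons in_cons negb_or eq_sym sS.
Qed.

Lemma act_stats w s : good w -> admissible w s ->
  [/\ ht (act w s) = ht w + rise s, path_length (act w s) = (path_length w).+1
    & count_mem Horiz (act w s) = (count_mem Horiz w + (s == Special))%N].
Proof.
move=> gw [sH hs so]; rewrite /act; case: eqVneq => [def_s|sS].
  have ow := so def_s; have [w' sl] := slide_exists gw ow.
  have [_ _ sw] := gw; rewrite def_s (E_rcons_slide sl sw).
  by have [-> -> ->] := slide_stats sl; rewrite addn1.
rewrite !htE !path_lengthE -cats1 count_cat /= (negPf sH) !addn0.
by split=> //; case: s sH {hs so sS} => //=; rewrite addn1.
Qed.

Lemma act_inj w1 w2 s1 s2 : good w1 -> good w2 ->
  admissible w1 s1 -> admissible w2 s2 -> act w1 s1 = act w2 s2 ->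
  w1 = w2 /\ s1 = s2.
Proof.
(* A flattening ends in [Horiz], unlike [s]. After an arch slide, deleting the final [Down] leaves
   the new horizontal step unsettled, so [v2] would not be good. *)
have mixed v1 v2 s : good v1 -> good v2 -> odd `|ht v1|%N -> s != Horiz ->
    act v1 Special = rcons v2 s -> False.
  move=> g1 g2 o1 sH; have [w' sl] := slide_exists g1 o1.
  have [_ _ sv] := g1; rewrite (act_slide sl sv).
  case: sl g1 o1 {sv} => [a|a p ep] g1 o1.
    by move=> /rcons_inj [_ def_s]; rewrite -def_s in sH.
  rewrite -rcons_cons -rcons_cat => /rcons_inj [def_v _].
  case: g2 => _ st _; rewrite -def_v in st; apply: open_not_settled st.
    by move: o1; rewrite ht_cat (excursion_arch ep).2 addr0.
  by case: ep.
move=> g1 g2 [sH1 _ so1] [sH2 _ so2]; rewrite {1 2}/act.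
case: eqVneq so1 => [->|S1] so1; case: eqVneq so2 => [->|S2] so2.
- have [w1' sl1] := slide_exists g1 (so1 erefl).
  have [w2' sl2] := slide_exists g2 (so2 erefl).
  have [[_ _ n1] [_ _ n2]] := (g1, g2).
  rewrite (E_rcons_slide sl1 n1) (E_rcons_slide sl2 n2) => eqw.
  rewrite eqw in sl1; split=> //.
  exact: slide_inj sl1 sl2 g1 g2 (so1 erefl) (so2 erefl).
- by move=> eqw; case: (mixed _ _ _ g1 g2 (so1 erefl) sH2 eqw).
- by move=> eqw; case: (mixed _ _ _ g2 g1 (so2 erefl) sH1 (esym eqw)).
by move=> /rcons_inj [].
Qed.

Lemma act_surj w : good w -> w != [::] ->
  exists v s, [/\ good v, admissible v s & act v s = w].
Proof.
case: (lastP w) => // {}w s [] /nonneg_from_rcons [nn hs] st.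
rewrite mem_rcons in_cons => /norP [sS sw] _; rewrite add0r in hs.
(* When [w] alone is settled, [s] is undone as an ordinary letter. *)
have keep : settled_from 0 w -> s != Horiz ->
    exists v t, [/\ good v, admissible v t & act v t = rcons w s].
  move=> stw sH; exists w, s; split=> //; first by split=> // def_s; rewrite def_s in sS.
  by rewrite /act eq_sym (negPf sS).
have prefix : nonneg_from 0 [:: s] -> settled_from 0 w.
  by apply: settled_from_prefix; rewrite cats1.
case: s sS st hs keep prefix => //= _ st hs keep prefix.
- apply: keep => //; apply: prefix.
  by apply/nonneg_from_cons; split=> //; apply/nonneg_from_nil.
- have [stw|/not_settled_leftmost] := pselect (settled_from 0 w).
    exact: keep.
  move=> [a [p [def_w oa nnp sta]]]; rewrite {}def_w in nn st hs sw *.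
  (* If [p] ended above its start, the final [Down] would not pass below the horizontal step, which
     would stay unsettled in the whole word. *)
  have ep : excursion p.
    split=> //; have := nonneg_from_ht nnp; rewrite add0r => hp.
    apply/eqP; rewrite eq_le hp andbT leNgt; apply/negP => hp1.
    apply: (@open_not_settled a (rcons p Down) oa); last by rewrite rcons_cat in st.
    by apply/nonneg_from_rcons; split=> //=; lia.
  have hv := (excursion_arch ep).2.
  exists (a ++ Up :: rcons p Down), Special.
  have sv : Special \notin a ++ Up :: rcons p Down.
    by move: sw; rewrite !mem_cat !in_cons mem_rcons in_cons.
  split; last first.
  + by rewrite (act_slide (SlideArch a ep) sv) rcons_cat.
  + split=> // [|_]; rewrite ht_cat hv addr0 //.
    by move: hs; rewrite !htE ep.2 /=; lia.
  split=> //.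
    move: nn => /nonneg_from_cat [nna _]; apply/nonneg_from_cat; split=> //.
    apply: nonneg_from_le (excursion_arch ep).1; exact: nonneg_from_ht.
  (* With the upstep restored, [p] starts at the even height [ht a + 1]. *)
  apply: settled_from_cat => //; apply: settled_from_cons => //.
  apply: settled_from_rcons => //; apply: settled_from_excursion => //=.
  by lia.
have stw : settled_from 0 w.
  by apply: prefix; apply/nonneg_from_cons; split=> //; apply/nonneg_from_nil.
(* A final [Horiz] in a settled word is at even height, so restoring the upstep gives the odd height
   that a special step requires. *)
have ew : ~~ odd `|ht w|%N.
  apply/negP => ow; apply: (@open_not_settled w [::] ow).
    exact/nonneg_from_nil.
  by rewrite cats1.
have sv : Special \notin rcons w Up by rewrite mem_rcons in_cons.
exists (rcons w Up), Special; split.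
- split=> //.
    by apply/nonneg_from_rcons; split=> //=; lia.
  exact: settled_from_rcons.
- by split=> // [|_]; rewrite ht_rcons /=; lia.
exact: act_slide (SlideFlat w) sv.
Qed.

(** * Processing a whole word *)

Definition special_prefix (x : seq step) : Prop :=
  [/\ nonneg_from 0 x, Horiz \notin x
    & forall i : nat, nth Horiz x i = Special -> odd `|height x i|%N].

Lemma special_prefix_nil : special_prefix [::].
Proof. by split=> [|//|i]; [apply/nonneg_from_nil | rewrite nth_nil]. Qed.

(** Leaving the final height free is what permits induction on the last letter. *)
Lemma special_prefix_rcons x s :
  special_prefix (rcons x s) <-> special_prefix x /\ admissible x s.
Proof.
rewrite /special_prefix /admissible (propext (nonneg_from_rcons _ _ _)) add0r.
rewrite mem_rcons in_cons negb_or [Horiz == s]eq_sym.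
split=> [[[nn hs] /andP [sH xH] xo]|].
  split; split=> //; [move=> i xi | move=> def_s].
    have lt_ix : (i < size x)%N.
      by case: ltnP xi => // le_xi; rewrite nth_default.
    have := xo i; rewrite nth_rcons lt_ix -cats1 height_cat ltnW //.
    exact.
  have := xo (size x); rewrite nth_rcons ltnn eqxx -cats1 height_cat leqnn.
  by rewrite height_size; apply.
case=> -[nn xH xo] [sH hs so]; split=> // [|i]; first by rewrite sH.
rewrite nth_rcons -cats1 height_cat; case: ltngtP => // [lt_ix|->].
  exact: xo.
by rewrite height_size.
Qed.

Definition process : seq step -> seq step := foldl act [::].

Lemma process_rcons x s : process (rcons x s) = act (process x) s.
Proof. exact: foldl_rcons. Qed.

Lemma process_spec x : special_prefix x ->
  [/\ good (process x), ht (process x) = ht x,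
      path_length (process x) = size x
    & count_mem Horiz (process x) = count_mem Special x].
Proof.
elim/last_ind: x => [_|x s IHx].
  split=> //; last by rewrite /path_length big_nil.
  by split=> //; [apply/nonneg_from_nil | apply: settled_from_nil].
rewrite process_rcons => /special_prefix_rcons -[/IHx [gx hx lx cx] ax].
(* Admissibility depends on the word only through its height, which processing preserves. *)
have {}ax : admissible (process x) s by rewrite /admissible hx.
have [-> -> ->] := act_stats gx ax; split.
- exact: act_good.
- by rewrite hx ht_rcons.
- by rewrite lx size_rcons.
by rewrite cx -cats1 count_cat /= addn0.
Qed.

Lemma process_admissible x s :
  special_prefix x -> admissible (process x) s <-> admissible x s.
Proof. by move=> /process_spec [_ hx _ _]; rewrite /admissible hx. Qed.

Lemma process_inj x y : special_prefix x -> special_prefix y ->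
  process x = process y -> x = y.
Proof.
elim/last_ind: x y => [|x s IHx] y; case: (lastP y) => [//|{}y t] px py.
- have [[_ _ lx _] [_ _ ly _]] := (process_spec px, process_spec py).
  by move=> eqp; move: lx; rewrite eqp ly size_rcons.
- have [[_ _ lx _] [_ _ ly _]] := (process_spec px, process_spec py).
  by move=> eqp; move: lx; rewrite eqp ly size_rcons.
move: px py => /special_prefix_rcons [px ax] /special_prefix_rcons [py ay].
have [[gx _ _ _] [gy _ _ _]] := (process_spec px, process_spec py).
rewrite !process_rcons => /act_inj [] //; try exact/process_admissible.
by move=> /(IHx _ px py) -> ->.
Qed.

(** The induction is on [path_length], which drops by one when a letter is undone; undoing a slide
    leaves the number of letters unchanged. *)
Lemma process_surj w : good w -> exists2 x, special_prefix x & process x = w.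
Proof.
have [m] := ubnP (path_length w); elim: m w => // m IHm w lt_wm gw.
have [->|w0] := eqVneq w [::]; first by exists [::]; first exact: special_prefix_nil.
have [v [s [gv av def_w]]] := act_surj gw w0.
have [_ lw _] := act_stats gv av.
have [|x px def_v] := IHm v _ gv; first by move: lt_wm; rewrite -def_w lw ltnS.
exists (rcons x s); last by rewrite process_rcons def_v.
by apply/special_prefix_rcons; split=> //; rewrite -process_admissible ?def_v.
Qed.

(** Reading an ordinary letter costs no application of [E]. A special letter costs one: the
    processed part has no special step, so it is the leftmost. *)
Lemma iter_E_process x r : special_prefix x ->
  exists m, iter m E (x ++ r) = process x ++ r.
Proof.
elim/last_ind: x r => [|x s IHx] r; first by exists 0%N.
rewrite process_rcons => /special_prefix_rcons -[px ax].
have [m def_m] := IHx (s :: r) px; have [gx _ _ _] := process_spec px.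
rewrite cat_rcons; have [def_s|sS] := eqVneq s Special; last first.
  by exists m; rewrite def_m /act (negPf sS) cat_rcons.
exists m.+1; rewrite iterS def_m def_s -cat_rcons.
move: ax; rewrite -process_admissible // => -[_ _ /(_ def_s) ox].
have [w' sl] := slide_exists gx ox; have [_ _ nx] := gx.
by rewrite (E_slide r sl nx) (act_slide sl nx).
Qed.

Lemma E_infty_process x : special_prefix x -> E_infty x = process x.
Proof.
move=> px; have [m] := iter_E_process [::] px; rewrite !cats0 => def_m.
have [[_ _ nx] _ _ _] := process_spec px.
by rewrite (@E_inftyE x m) def_m.
Qed.

(** * Translation to lattice paths and conclusion *)

Lemma height_unlabel p i : height (map unlabel p) i = height p i.
Proof. by rewrite /height -map_take big_map; apply: eq_bigr => -[]. Qed.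

Lemma odd_special_dyck_pathE n p :
  odd_special_dyck_path n p <-> [/\ special_prefix p, size p = n & ht p = 0].
Proof.
have Hp : (Horiz \in map unlabel p) = (Horiz \in p).
  by elim: p => // -[] p IHp; rewrite /= !in_cons IHp.
have Sp : Special \notin map unlabel p by elim: p {Hp} => // -[].
have lp : Horiz \notin p -> path_length (map unlabel p) = size p.
  rewrite /path_length big_map; elim: p {Hp Sp} => [|s p IHp].
    by rewrite big_nil.
  rewrite in_cons negb_or big_cons => /andP [sH /IHp ->].
  by case: s sH.
have nn : (forall i, 0 <= height (map unlabel p) i) <-> nonneg_from 0 p.
  by split=> nn i; have := nn i; rewrite height_unlabel add0r.
rewrite /odd_special_dyck_path /dyck_path /lattice_path (propext nn) Hp Sp.
rewrite size_map height_unlabel height_size; split.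
  by case=> -[[ln np hp] [pH _]] po; split=> //; rewrite -lp.
by case=> -[np pH po] sn hp; do !split=> //; rewrite lp.
Qed.

(** A nonnegative word ending at height 0 is settled automatically: an odd height is positive, so
    the end of the word is lower. *)
Lemma big_schroeder_pathE n p :
  big_schroeder_path n p <-> [/\ good p, path_length p = n & ht p = 0].
Proof.
rewrite /big_schroeder_path /lattice_path /good height_size.
have nn : (forall i, 0 <= height p i) <-> nonneg_from 0 p.
  by split=> nn i; have := nn i; rewrite add0r.
rewrite (propext nn); split=> [[[ln np hp] pS]|[[np sp pS] ln hp]]; last by [].
do 2![split=> //] => i /nth_Horiz_size lt_ip oi.
exists (size p) => //; rewrite height_size hp; have := np i.
by rewrite add0r => ?; lia.
Qed.

Local Open Scope classical_set_scope.

Theorem corollary2 (n k : nat) :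
  set_bij
    [set p : seq step | odd_special_dyck_path n p /\ count_mem Special p = k]
    [set p : seq step | big_schroeder_path n p /\ count_mem Horiz p = k]
    E_infty.
Proof.
split.
- move=> x /= [/odd_special_dyck_pathE [px sx hx] cx].
  rewrite E_infty_process // big_schroeder_pathE.
  by have [gx -> -> ->] := process_spec px.
- move=> x y; rewrite !inE /= !odd_special_dyck_pathE.
  move=> [[px _ _] _] [[py _ _] _]; rewrite !E_infty_process //.
  exact: process_inj.
move=> w /= [/big_schroeder_pathE [gw lw hw] cw].
have [x px def_w] := process_surj gw; have [_ hx lx cx] := process_spec px.
exists x; last by rewrite E_infty_process.
by rewrite /= odd_special_dyck_pathE -cx -hx -lx def_w.
Qed.
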